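(* Let $M,K\in\mathbb{R}^{n_\Gamma\times n_\Gamma}$ be the mass and stiffness matrices of a finite element discretization on $\Gamma$. Let $N\in\mathbb{N}$ and let $A,B\in\mathbb{C}^{(N+1)\times(N+1)}$ be partitioned as $$A=\begin{bmatrix} A_{\Gamma\Gamma} & A_{\Gamma E} \\ A_{E\Gamma} & A_{EE} \end{bmatrix},\qquad B=\begin{bmatrix} B_{\Gamma\Gamma} & B_{\Gamma E} \\ B_{E\Gamma} & B_{EE} \end{bmatrix}$$ with $A_{\Gamma\Gamma},B_{\Gamma\Gamma}\in\mathbb{C}$ and $A_{EE},B_{EE}\in\mathbb{C}^{N\times N}$. Define $L_{\Gamma\Gamma},L_{\Gamma E},L_{E\Gamma},L_{EE}$ by $$\begin{bmatrix} L_{\Gamma\Gamma} & L_{\Gamma E} \\ L_{E\Gamma} & L_{EE} \end{bmatrix}=A\otimes M+B\otimes K,$$ where the blocks correspond to the partition of $A$ and $B$ (so $L_{XY}=A_{XY}\otimes M+B_{XY}\otimes K$ for $X,Y\in\{\Gamma,E\}$). Assume $L_{EE}$ is invertible and define $$\operatorname{DtN}:=M^{-1}\left(L_{\Gamma\Gamma}-L_{\Gamma E}L_{EE}^{-1}L_{E\Gamma}\right)\in\mathbb{C}^{n_\Gamma\times n_\Gamma}.$$ If $(\lambda_\ell,v_\ell)$ is an eigenpair of the discrete Laplace-Beltrami operator $-\Delta_{\Gamma,h}=M^{-1}K$ on $\Gamma$, then $$\operatorname{DtN}v_\ell=\operatorname{dtn}(\lambda_\ell)\,v_\ell,$$ where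 $\operatorname{dtn}$ is the rational function defined for $\lambda\in\mathbb{C}$ by $$\operatorname{dtn}(\lambda):=A_{\Gamma\Gamma}+\lambda B_{\Gamma\Gamma}-(A_{\Gamma E}+\lambda B_{\Gamma E})(A_{EE}+\lambda B_{EE})^{-1}(A_{E\Gamma}+\lambda B_{E\Gamma}).$$
   Context: $\Gamma\subset\partial\Omega_{\mathrm{int}}$ is part of the boundary of a bounded domain $\Omega_{\mathrm{int}}\subset\mathbb{R}^d$, and $\phi_1,\dots,\phi_{n_\Gamma}$ are the (real-valued, linearly independent) finite element shape functions on $\Gamma$. The mass matrix is $M=\left(\int_\Gamma\phi_i\phi_j\,d\hat x\right)_{ij}$, which is symmetric positive definite, and the stiffness matrix is $K=\left(\int_\Gamma\nabla_\Gamma\phi_i\cdot\nabla_\Gamma\phi_j\,d\hat x\right)_{ij}$, which is symmetric positive semidefinite, where $\nabla_\Gamma$ is the surface gradient. The discrete Laplace-Beltrami operator is the matrix $-\Delta_{\Gamma,h}:=M^{-1}K$. An eigenpair $(\lambda_\ell,v_\ell)$ of it consists of a number $\lambda_\ell$ and a nonzero vector $v_\ell$ with $M^{-1}Kv_\ell=\lambda_\ell v_\ell$. For an $m\times n$ matrix $C$ and a $p\times q$ matrix $D$, the Kronecker product $C\otimes D$ is the $mp\times nq$ block matrix whose $(i,j)$ block is $c_{ij}D$. The function $\operatorname{dtn}$ is understood as a rational function of $\lambda$, evaluated by the displayed formula wherever $A_{EE}+\lambda B_{EE}$ is invertible. *)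

(* Defs.v *)
From HB Require Import structures.
From mathcomp Require Import all_boot all_order all_algebra.
From mathcomp Require Import all_classical all_reals all_analysis.
From mathcomp Require Import ring complex mxtens.

Set Implicit Arguments.
Unset Strict Implicit.
Unset Printing Implicit Defensive.

Import Order.TTheory GRing.Theory Num.Theory.
Import numFieldNormedType.Exports.

Local Open Scope classical_set_scope.
Local Open Scope ring_scope.

(* The norm that MathComp-Analysis puts on 'rV[R]_d is the maximum norm, so the
   Euclidean structure of R^d, on which surface measure depends, is set up
   here. *)
Section Euclidean.
Context {R : realType} {d : nat}.

Definition dotp (u v : 'rV[R]_d) : R := \sum_(k < d) u 0 k * v 0 k.

Definition enorm (u : 'rV[R]_d) : R := Num.sqrt (dotp u u).

(* -oo for the empty set *)
Definition diam (U : set 'rV[R]_d) : \bar R :=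
  ereal_sup [set (enorm (z.1 - z.2))%:E | z in U `*` U].

End Euclidean.

(* Volume of the unit ball of R^k. *)
Fixpoint ball_volume (R : realType) (k : nat) : R :=
  match k with
  | 0 => 1
  | 1 => 2
  | (k'.+1 as k1).+1 => 2 * pi / k1.+1%:R * ball_volume R k'
  end.

(* Surface measure on a hypersurface of R^d is the (d-1)-dimensional Hausdorff
   measure, normalised so that it extends (d-1)-dimensional Lebesgue measure. *)
Section Hausdorff.
Local Open Scope ereal_scope.
Context (R : realType) (d k : nat).

(* The weight of a set in a cover; +oo excludes the sets of diameter larger
   than delta from the covers. *)
Definition hausdorff_weight (delta : R) (U : set 'rV[R]_d) : \bar R :=
  if U == set0 then 0
  else if diam U <= delta%:E then
    (ball_volume R k / 2 ^+ k)%:E * diam U ^+ k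
  else +oo.

(* mu_ext ranges over the covers by measurable sets; in this sigma-algebra
   every set is measurable. *)
Definition all_measurable : Type := g_sigma_algebraType [set: set 'rV[R]_d].

HB.instance Definition _ := Measurable.on all_measurable.

Definition hausdorff (X : set 'rV[R]_d) : \bar R :=
  ereal_sup [set mu_ext (hausdorff_weight delta : set all_measurable -> \bar R) X
            | delta in [set delta : R | (0 < delta)%R]].

Lemma ball_volume_ge0 j : (0 <= ball_volume R j)%R.
Proof.
suff: (0 <= ball_volume R j)%R /\ (0 <= ball_volume R j.+1)%R by case.
elim: j => [|j [ih1 ih2]]; first by split.
split=> //=; apply: mulr_ge0 => //.
by rewrite divr_ge0// mulr_ge0// pi_ge0.
Qed.

Lemma hausdorff_weight0 delta : hausdorff_weight delta set0 = 0.
Proof. by rewrite /hausdorff_weight eqxx. Qed.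

Lemma hausdorff_weight_ge0 delta U : 0 <= hausdorff_weight delta U.
Proof.
rewrite /hausdorff_weight; case: eqP => // /eqP/set0P[x Ux].
case: ifP => // _; apply: mule_ge0.
  by rewrite lee_fin divr_ge0 ?ball_volume_ge0.
apply: expe_ge0; apply: ereal_sup_ubound; exists (x, x) => //=.
congr EFin; rewrite subrr /enorm /dotp big1 ?sqrtr0// => i _.
by rewrite mxE mul0r.
Qed.

Lemma hausdorff_set0 : hausdorff set0 = 0.
Proof.
apply/eqP; rewrite eq_le; apply/andP; split.
  apply: ge_ereal_sup => _ [delta _ <-].
  by rewrite mu_ext0//; [exact: hausdorff_weight0|exact: hausdorff_weight_ge0].
apply: (@le_trans _ _
  (mu_ext (hausdorff_weight 1 : set all_measurable -> \bar R) set0)).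
  exact/mu_ext_ge0/hausdorff_weight_ge0.
by apply: ereal_sup_ubound; exists 1%R => //=.
Qed.

Lemma hausdorff_ge0 X : 0 <= hausdorff X.
Proof.
apply: (@le_trans _ _
  (mu_ext (hausdorff_weight 1 : set all_measurable -> \bar R) X)).
  exact/mu_ext_ge0/hausdorff_weight_ge0.
by apply: ereal_sup_ubound; exists 1%R => //=.
Qed.

Lemma le_hausdorff : {homo hausdorff : X Y / X `<=` Y >-> X <= Y}.
Proof.
move=> X Y XY; apply: ge_ereal_sup => _ [delta delta0 <-].
apply: (@le_trans _ _
  (mu_ext (hausdorff_weight delta : set all_measurable -> \bar R) Y)).
  exact: le_mu_ext.
by apply: ereal_sup_ubound; exists delta.
Qed.

Lemma hausdorff_sigma_subadditive : sigma_subadditive hausdorff.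
Proof.
move=> F; apply: ge_ereal_sup => _ [delta delta0 <-].
apply: le_trans.
  exact: (@mu_ext_sigma_subadditive _ all_measurable R
    (hausdorff_weight delta) (hausdorff_weight_ge0 delta) F).
apply: lee_nneseries => [i _ _|i _].
  exact/mu_ext_ge0/hausdorff_weight_ge0.
by apply: ereal_sup_ubound; exists delta.
Qed.

HB.instance Definition _ := isOuterMeasure.Build R 'rV[R]_d hausdorff
  hausdorff_set0 hausdorff_ge0 le_hausdorff hausdorff_sigma_subadditive.

End Hausdorff.

Definition surface_outer (R : realType) (d : nat) :
  {outer_measure set 'rV[R]_d -> \bar R} := @hausdorff R d d.-1.

(* Surface measure lives on the sigma-algebra of its Caratheodory measurable
   sets, which contains the Borel sets. *)
Definition surface_measure (R : realType) (d : nat) :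
  {measure set (caratheodory_type (surface_outer R d)) -> \bar R} :=
  surface_outer R d.

Section SurfaceGradient.
Context {R : realType} {d : nat}.
Implicit Types (Gamma : set 'rV[R]_d) (f : 'rV[R]_d -> R) (x g w : 'rV[R]_d).

(* f y = f x + g . (y - x) + o(|y - x|) as y tends to x within Gamma *)
Definition is_gradient_within Gamma f x g : Prop :=
  forall e : R, 0 < e -> \forall y \near x, Gamma y ->
    `|f y - f x - dotp g (y - x)| <= e * enorm (y - x).

(* w . (y - x) = o(|y - x|) as y tends to x within Gamma *)
Definition is_normal Gamma x w : Prop := is_gradient_within Gamma (cst 0) x w.

(* At a regular point of a hypersurface, the gradients of f within Gamma are
   determined up to a multiple of the unit normal, and the surface gradient is
   the tangential one. *)
Definition is_surface_gradient Gamma f x g : Prop :=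
  is_gradient_within Gamma f x g /\
  forall w, is_normal Gamma x w -> dotp g w = 0.

Definition surface_gradient Gamma f x : 'rV[R]_d :=
  xget 0 [set g | is_surface_gradient Gamma f x g].

Lemma dotpBl (u v w : 'rV[R]_d) : dotp (u - v) w = dotp u w - dotp v w.
Proof.
by rewrite /dotp -sumrB; apply: eq_bigr => i _; rewrite !mxE mulrBl.
Qed.

Lemma surface_gradient_unique Gamma f x g h :
  is_surface_gradient Gamma f x g -> is_surface_gradient Gamma f x h -> g = h.
Proof.
move=> [dg tg] [dh th].
have gh : is_normal Gamma x (g - h).
  move=> e e0; have e20 : 0 < e / 2 by rewrite divr_gt0.
  near=> y => Gy.
  rewrite subrr sub0r normrN dotpBl.
  have -> : dotp g (y - x) - dotp h (y - x) =
     (f y - f x - dotp h (y - x)) - (f y - f x - dotp g (y - x)).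
    by ring.
  rewrite (le_trans (ler_normB _ _))// [e]splitr mulrDl lerD//.
    by move: Gy; near: y; exact: dh.
  by move: Gy; near: y; exact: dg.
have : dotp (g - h) (g - h) = 0 by rewrite dotpBl tg// th// subrr.
move/eqP; rewrite /dotp psumr_eq0; last by move=> i _; rewrite -expr2 sqr_ge0.
move=> /allP gh0; apply/rowP => i; apply/eqP; rewrite -subr_eq0.
by have := gh0 i; rewrite mem_index_enum !mxE mulf_eq0 orbb => /(_ isT).
Unshelve. all: by end_near. Qed.

End SurfaceGradient.

Section FiniteElements.
Context {R : realType} {d : nat}.
Local Notation mu := (surface_measure R d).

Record bounded_domain (Omega : set 'rV[R]_d) : Prop := {
  domain_nonempty : Omega !=set0;
  domain_open : open Omega;
  domain_connected : connected Omega;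
  domain_bounded : bounded_set Omega }.

Definition boundary (Omega : set 'rV[R]_d) : set 'rV[R]_d :=
  closure Omega `\` Omega°.

(* The properties of finite element shape functions on Gamma that the
   definition of the mass and stiffness matrices rests on: they are square
   integrable, they have a square integrable surface gradient almost everywhere
   (finite element functions are piecewise smooth), and they are linearly
   independent as elements of L^2(Gamma). *)
Record shape_functions (Gamma : set 'rV[R]_d) (n : nat)
    (phi : 'I_n -> 'rV[R]_d -> R) : Prop := {
  shape_measurable : forall i,
    measurable_fun (Gamma : set (caratheodory_type (surface_outer R d)))
      (phi i);
  shape_square_integrable : forall i,
    mu.-integrable Gamma (fun x => (phi i x ^+ 2)%:E);
  shape_gradient : forall i, {ae mu, forall x, Gamma x ->
    exists g, is_surface_gradient Gamma (phi i) x g};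
  shape_gradient_measurable : forall i k,
    measurable_fun (Gamma : set (caratheodory_type (surface_outer R d)))
      (fun x => surface_gradient Gamma (phi i) x 0 k);
  shape_gradient_square_integrable : forall i,
    mu.-integrable Gamma
      (fun x => (enorm (surface_gradient Gamma (phi i) x) ^+ 2)%:E);
  shape_independent : forall c : 'I_n -> R,
    {ae mu, forall x, Gamma x -> \sum_(i < n) c i * phi i x = 0} ->
    forall i, c i = 0 }.

Definition mass_matrix (Gamma : set 'rV[R]_d) (n : nat)
    (phi : 'I_n -> 'rV[R]_d -> R) : 'M[R]_n :=
  \matrix_(i, j) \int[mu]_(x in Gamma) (phi i x * phi j x).

Definition stiffness_matrix (Gamma : set 'rV[R]_d) (n : nat)
    (phi : 'I_n -> 'rV[R]_d -> R) : 'M[R]_n :=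
  \matrix_(i, j) \int[mu]_(x in Gamma)
    dotp (surface_gradient Gamma (phi i) x) (surface_gradient Gamma (phi j) x).

End FiniteElements.

Section DtN.
Context {R : realType} {n N : nat}.
Local Notation C := R[i].
Implicit Types (M K : 'M[R]_n) (A B : 'M[C]_(1 + N)).

Definition complexmx {m p : nat} (X : 'M[R]_(m, p)) : 'M[C]_(m, p) :=
  map_mx (real_complex R) X.

Definition laplace_beltrami M K : 'M[R]_n := invmx M *m K.

Definition eigenpair (X : 'M[R]_n) (lambda : C) (v : 'cV[C]_n) : Prop :=
  v != 0 /\ complexmx X *m v = lambda *: v.

(* The cast regroups the (1 + N) * n indices as n + N * n, so that the blocks
   of L correspond to those of A and B. *)
Definition Lmx M K A B : 'M[C]_(n + N * n) :=
  castmx (mulSn N n, mulSn N n)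
    (A *t complexmx M + B *t complexmx K).

Definition L_GG M K A B : 'M[C]_n := ulsubmx (Lmx M K A B).
Definition L_GE M K A B : 'M[C]_(n, N * n) := ursubmx (Lmx M K A B).
Definition L_EG M K A B : 'M[C]_(N * n, n) := dlsubmx (Lmx M K A B).
Definition L_EE M K A B : 'M[C]_(N * n) := drsubmx (Lmx M K A B).

Lemma cast_lshift (i : 'I_n) :
  cast_ord (esym (mulSn N n)) (lshift (N * n) i) =
  mxtens_index (lshift N (0 : 'I_1), i) :> 'I_((1 + N) * n).
Proof. exact: val_inj. Qed.

Lemma cast_rshift (i : 'I_N) (j : 'I_n) :
  cast_ord (esym (mulSn N n)) (rshift n (mxtens_index (i, j))) =
  mxtens_index (rshift 1 i, j) :> 'I_((1 + N) * n).
Proof. by apply: val_inj; rewrite /= mulSn addnA. Qed.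

(* The 1 * n indices of a Gamma block of the Kronecker product are identified
   with n indices. *)
Lemma L_GGE M K A B : L_GG M K A B =
  ulsubmx A 0 0 *: complexmx M + ulsubmx B 0 0 *: complexmx K.
Proof.
apply/matrixP => i j; rewrite 2!mxE castmxE !cast_lshift [LHS]mxE !tensmxE.
by rewrite !mxE.
Qed.

Lemma L_GEE M K A B : L_GE M K A B =
  castmx (mul1n n, erefl)
    (ursubmx A *t complexmx M + ursubmx B *t complexmx K).
Proof.
apply/matrixP => i j; case: (mxtens_indexP j) => {}j k.
rewrite 2!mxE !castmxE cast_lshift cast_rshift cast_ord_id.
have -> : cast_ord (esym (mul1n n)) i = mxtens_index (0 : 'I_1, i).
  exact: val_inj.
by rewrite [LHS]mxE [RHS]mxE !tensmxE !mxE.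
Qed.

Lemma L_EGE M K A B : L_EG M K A B =
  castmx (erefl, mul1n n)
    (dlsubmx A *t complexmx M + dlsubmx B *t complexmx K).
Proof.
apply/matrixP => j i; case: (mxtens_indexP j) => {}j k.
rewrite 2!mxE !castmxE cast_lshift cast_rshift cast_ord_id.
have -> : cast_ord (esym (mul1n n)) i = mxtens_index (0 : 'I_1, i).
  exact: val_inj.
by rewrite [LHS]mxE [RHS]mxE !tensmxE !mxE.
Qed.

Lemma L_EEE M K A B : L_EE M K A B =
  drsubmx A *t complexmx M + drsubmx B *t complexmx K.
Proof.
apply/matrixP => i j; case: (mxtens_indexP i) => {}i k.
case: (mxtens_indexP j) => {}j l.
rewrite 2!mxE castmxE !cast_rshift.
by rewrite [LHS]mxE [RHS]mxE !tensmxE !mxE.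
Qed.

Definition DtN M K A B : 'M[C]_n :=
  invmx (complexmx M) *m
  (L_GG M K A B - L_GE M K A B *m invmx (L_EE M K A B) *m L_EG M K A B).

(* lambda is in the domain of dtn when this matrix is invertible *)
Definition dtn_denom A B (lambda : C) : 'M[C]_N :=
  drsubmx A + lambda *: drsubmx B.

Definition dtn A B (lambda : C) : C :=
  (ulsubmx A + lambda *: ulsubmx B
   - (ursubmx A + lambda *: ursubmx B) *m invmx (dtn_denom A B lambda)
     *m (dlsubmx A + lambda *: dlsubmx B)) 0 0.

End DtN.

(* Main.v *)
Require Import Defs.
From HB Require Import structures.
From mathcomp Require Import all_boot all_order all_algebra.
From mathcomp Require Import all_classical all_reals all_analysis.
From mathcomp Require Import complex.
From mathcomp Require Import lra mxtens measurable_realfun.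

Set Implicit Arguments.
Unset Strict Implicit.
Unset Printing Implicit Defensive.

Import Order.TTheory GRing.Theory Num.Theory.
Import numFieldNormedType.Exports.

Local Open Scope classical_set_scope.
Local Open Scope ring_scope.

(** An eigenpair of [M^-1 K] is a generalized eigenpair [K v = lambda M v],
    because the mass matrix is invertible.  On vectors of the form [y (x) v],
    the Kronecker pencil then acts by the scalar pencil on the first factor and
    by [M] on the second,
    [(X (x) M + Y (x) K) (y (x) v) = ((X + lambda Y) y) (x) (M v)]
    ([kron_pencil_mul]).  Every block of [L] is such a pencil, so the Schur
    complement of [L], applied to [v], becomes the Schur complement of
    [A + lambda B] times [M v], and multiplying by [M^-1] leaves [v]
    ([DtN_eigenvector]).

    The same identity gives the invertibility of [A_EE + lambda B_EE]
    ([dtn_denom_unitmx]): a kernel vector [y] would produce the kernel vector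
    [y (x) v] of [L_EE], and this is nonzero when [y] is, since [v != 0].

    The analytic input is the invertibility of the mass matrix, the Gram matrix
    of the shape functions in [L^2] ([gram_unitmx]): if [M c = 0], then
    [c^T M c], the integral of the square of [\sum_i c_i phi_i], vanishes, so
    this sum is zero almost everywhere and linear independence gives [c = 0]. *)

(** * Invertibility of Gram matrices *)

Lemma unitmx_kernel0 (F : fieldType) n (X : 'M[F]_n) :
  (forall y : 'cV_n, X *m y = 0 -> y = 0) -> X \in unitmx.
Proof.
move=> X0; rewrite -unitmx_tr -row_free_unit -kermx_eq0.
apply/rowV0P => u /sub_kermxP uX; apply: trmx_inj; rewrite trmx0; apply: X0.
by apply: trmx_inj; rewrite trmx_mul trmxK uX trmx0.
Qed.

Section Gram.
Context {R : realType} {disp : measure_display} {T : measurableType disp}.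
Context (mu : {measure set T -> \bar R}) (D : set T) (mD : measurable D).
Implicit Types f g : T -> R.

(** Since [2 |f g| <= f^2 + g^2]; this makes the entries of a Gram matrix
    genuine integrals, so that linearity applies to them. *)
Lemma integrable_mul_of_sqr f g :
  measurable_fun D f -> measurable_fun D g ->
  mu.-integrable D (fun x => (f x ^+ 2)%:E) ->
  mu.-integrable D (fun x => (g x ^+ 2)%:E) ->
  mu.-integrable D (fun x => (f x * g x)%:E).
Proof.
move=> mf mg f2 g2.
apply: (le_integrable mD _ _ (integrableD mD f2 g2)).
  by apply/measurable_EFinP; exact: measurable_funM.
move=> x _; rewrite /= lee_fin (ger0_norm (addr_ge0 (sqr_ge0 _) (sqr_ge0 _))).
have := sqr_ge0 (f x - g x); have := sqr_ge0 (f x + g x) => ? ?.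
by rewrite ler_norml; apply/andP; split; nra.
Qed.

(** The quadratic form of the Gram matrix at [c] is the integral of the square
    of [\sum_i c_i phi_i], which vanishes only if this combination is zero
    almost everywhere. *)
Lemma gram_unitmx n (phi : 'I_n -> T -> R) :
  (forall i, measurable_fun D (phi i)) ->
  (forall i, mu.-integrable D (fun x => (phi i x ^+ 2)%:E)) ->
  (forall c : 'I_n -> R,
    {ae mu, forall x, D x -> \sum_(i < n) c i * phi i x = 0} ->
    forall i, c i = 0) ->
  (\matrix_(i, j) \int[mu]_(x in D) (phi i x * phi j x) : 'M[R]_n) \in unitmx.
Proof.
move=> mphi phi2 phi_indep; apply: unitmx_kernel0 => c Gc0.
set G := (\matrix_(i, j) _) in Gc0.
pose s x := \sum_(i < n) c i 0 * phi i x.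
have phiM i j : mu.-integrable D (fun x => (phi i x * phi j x)%:E).
  exact: integrable_mul_of_sqr.
have s2E x : (s x ^+ 2)%:E =
    (\sum_(p : 'I_n * 'I_n) (c p.1 0 * c p.2 0)%:E *
                            (phi p.1 x * phi p.2 x)%:E)%E.
  rewrite expr2 /s mulr_suml; under eq_bigr do rewrite mulr_sumr.
  rewrite pair_big sumEFin; congr EFin; apply: eq_bigr => p _ /=.
  by rewrite mulrACA.
have int_s2 : (\int[mu]_(x in D) (s x ^+ 2)%:E = 0)%E.
  under eq_integral do rewrite s2E.
  rewrite integral_sum//; last by move=> p; exact: integrableZl.
  under eq_bigr => p _.
    rewrite integralZl// -(fineK (integrable_fin_num mD (phiM p.1 p.2))).
    rewrite -EFinM.
    over.
  rewrite sumEFin; congr EFin.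
  rewrite -(pair_big xpredT xpredT (fun i j => c i 0 * c j 0 *
    fine (\int[mu]_(x in D) (phi i x * phi j x)%:E)%E))/=.
  rewrite big1// => i _.
  have /matrixP/(_ i 0) := Gc0; rewrite !mxE => Gc0i.
  transitivity (c i 0 * \sum_j G i j * c j 0); last by rewrite Gc0i mulr0.
  rewrite mulr_sumr; apply: eq_bigr => j _.
  by rewrite mxE -mulrA [X in _ * X]mulrC.
have ms : measurable_fun D s.
  apply: measurable_sum => i.
  exact: (measurable_funM (measurable_cst _) (mphi i)).
have s20 : ae_eq mu D (fun x => (s x ^+ 2)%:E) (cst 0%E).
  apply/ae_eq_integral_abs => //.
    by apply/measurable_EFinP; exact: measurable_funX.
  rewrite -int_s2; apply: eq_integral => x _.
  by rewrite gee0_abs// lee_fin sqr_ge0.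
apply/colP => i; rewrite mxE; apply: (phi_indep (c ^~ 0) _ i).
apply: filterS s20 => x /= s0 /s0 [] /eqP.
by rewrite sqrf_eq0 => /eqP.
Qed.

End Gram.

(** * Kronecker pencils on simple tensors *)

Section Pencil.
Context {F : comPzRingType}.

Lemma tensmxDl m n p q (X Y : 'M[F]_(m, n)) (Z : 'M[F]_(p, q)) :
  (X + Y) *t Z = X *t Z + Y *t Z.
Proof.
apply/matrixP => i j; case: (mxtens_indexP i) => {}i k.
case: (mxtens_indexP j) => {}j l.
by rewrite [RHS]mxE !tensmxE mxE mulrDl.
Qed.

Lemma tensmxZ m n p q a (X : 'M[F]_(m, n)) (Z : 'M[F]_(p, q)) :
  X *t (a *: Z) = (a *: X) *t Z.
Proof.
apply/matrixP => i j; case: (mxtens_indexP i) => {}i k.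
case: (mxtens_indexP j) => {}j l.
by rewrite !tensmxE !mxE mulrCA mulrA.
Qed.

Lemma tensmx_cV_eq0 (D : idomainType) m n (y : 'cV[D]_m) (w : 'cV[D]_n) :
  w != 0 -> y *t w = 0 -> y = 0.
Proof.
move=> /cV0Pn[k wk0] /matrixP yw; apply/colP => i; rewrite mxE.
have := yw (mxtens_index (i, k)) (mxtens_index (0, 0)).
by rewrite tensmxE mxE => /eqP; rewrite mulf_eq0 (negPf wk0) orbF => /eqP.
Qed.

(** A generalized eigenvector [v] of [(K, M)] reduces the Kronecker pencil to
    the scalar pencil: by the mixed-product rule [K] contributes
    [lambda (M v)], and [lambda] moves to the first factor. *)
Lemma kron_pencil_mul m p n (X Y : 'M[F]_(m, p)) (M K : 'M[F]_n) lambda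
    (v : 'cV[F]_n) (y : 'cV[F]_p) :
  K *m v = lambda *: (M *m v) ->
  (X *t M + Y *t K) *m (y *t v) = ((X + lambda *: Y) *m y) *t (M *m v).
Proof.
move=> Kv; rewrite mulmxDl !tensmx_mul Kv tensmxZ -tensmxDl.
by rewrite mulmxDl scalemxAl.
Qed.

(** This removes the casts between [1 * n] and [n] in the blocks of [L] with a
    one-dimensional Gamma index. *)
Lemma castmx_tens11 n (z : 'M[F]_1) (w : 'cV[F]_n) :
  castmx (mul1n n, erefl) (z *t w) = z 0 0 *: w.
Proof.
by rewrite {1}[z]mx11_scalar tens_scalar_mx castmx_comp castmx_id.
Qed.

End Pencil.

(** * The discrete Dirichlet-to-Neumann operator *)

Section DiscreteDtN.
Context {R : realType} {n N : nat}.
Implicit Types (M K : 'M[R]_n) (A B : 'M[R[i]]_(1 + N)) (v : 'cV[R[i]]_n).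

Lemma eigenpair_generalized M K lambda v :
  M \in unitmx -> eigenpair (laplace_beltrami M K) lambda v ->
  complexmx K *m v = lambda *: (complexmx M *m v).
Proof.
move=> Mu [_ Xv]; rewrite scalemxAr -Xv mulmxA /complexmx -map_mxM.
by rewrite /laplace_beltrami mulKVmx.
Qed.

(** If [y] is in the kernel of [A_EE + lambda B_EE], then [y (x) v] is in the
    kernel of [L_EE]. *)
Lemma dtn_denom_unitmx M K A B lambda v :
  v != 0 -> complexmx K *m v = lambda *: (complexmx M *m v) ->
  L_EE M K A B \in unitmx -> dtn_denom A B lambda \in unitmx.
Proof.
move=> v0 Kv Lu; apply: unitmx_kernel0 => y Dy; apply: (tensmx_cV_eq0 v0).
apply: (can_inj (mulKmx Lu)).
by rewrite mulmx0 L_EEE (kron_pencil_mul _ _ _ Kv) Dy tens0mx.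
Qed.

(** All intermediate vectors stay simple tensors: with
    [a_XY = A_XY + lambda B_XY], [L_EG v] is [a_EG (x) M v], inverting [L_EE] turns it into [z (x) v] with
    [z = a_EE^-1 a_EG], and [L_GE] returns the scalar
    [a_GE z] times [M v]. *)
Lemma DtN_eigenvector M K A B lambda v :
  M \in unitmx -> complexmx K *m v = lambda *: (complexmx M *m v) ->
  L_EE M K A B \in unitmx -> dtn_denom A B lambda \in unitmx ->
  DtN M K A B *m v = dtn A B lambda *: v.
Proof.
move=> Mu Kv Lu Du; set w := complexmx M *m v.
pose a_GE := ursubmx A + lambda *: ursubmx B.
pose a_EG := dlsubmx A + lambda *: dlsubmx B.
pose z := invmx (dtn_denom A B lambda) *m a_EG.
have LGGv : L_GG M K A B *m v = (ulsubmx A + lambda *: ulsubmx B) 0 0 *: w.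
  rewrite L_GGE mulmxDl -!scalemxAl Kv -/w scalerA -scalerDl !mxE.
  by rewrite [_ * lambda]mulrC.
have LEGv : L_EG M K A B *m v = a_EG *t w.
  (* v is viewed as the simple tensor 1 (x) v, so that the pencil acts on it *)
  have vE : v = castmx (mul1n n, erefl) (1%:M *t v).
    by rewrite castmx_tens11 mxE scale1r.
  rewrite L_EGE {1}vE mulmx_cast castmx_comp !castmx_id.
  by rewrite (kron_pencil_mul _ _ _ Kv) mulmx1.
have LEEz : invmx (L_EE M K A B) *m (a_EG *t w) = z *t v.
  apply: (can_inj (mulKmx Lu)); rewrite mulKVmx// L_EEE.
  by rewrite (kron_pencil_mul _ _ _ Kv) -/(dtn_denom A B lambda) mulKVmx.
have LGEz : L_GE M K A B *m (z *t v) = (a_GE *m z) 0 0 *: w.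
  rewrite L_GEE -castmx_tens11 -(kron_pencil_mul _ _ _ Kv).
  by rewrite castmx_mul castmx_id.
rewrite /DtN -!mulmxA mulmxBl LGGv -!mulmxA LEGv LEEz LGEz -scalerBl.
rewrite -scalemxAr mulKmx ?map_unitmx//; congr (_ *: v).
by rewrite /dtn [RHS]mxE [X in _ = _ + X]mxE -mulmxA.
Qed.

End DiscreteDtN.

Theorem proposition2p1 (R : realType) (d : nat)
    (Omega_int Gamma : set 'rV[R]_d)
    (n_Gamma : nat) (phi : 'I_n_Gamma -> 'rV[R]_d -> R)
    (N : nat) (A B : 'M[R[i]]_(1 + N))
    (lambda : R[i]) (v : 'cV[R[i]]_n_Gamma) :
  let M := mass_matrix Gamma phi in
  let K := stiffness_matrix Gamma phi in
  bounded_domain Omega_int ->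
  Gamma `<=` boundary Omega_int ->
  (surface_outer R d).-cara.-measurable Gamma ->
  shape_functions Gamma phi ->
  L_EE M K A B \in unitmx ->
  eigenpair (laplace_beltrami M K) lambda v ->
  dtn_denom A B lambda \in unitmx /\
  DtN M K A B *m v = dtn A B lambda *: v.
Proof.
move=> M K _ _ mGamma phiP LEE_unit eig.
have Mu : M \in unitmx.
  apply: (gram_unitmx mGamma).
  - exact: shape_measurable phiP.
  - exact: shape_square_integrable phiP.
  - exact: shape_independent phiP.
have Kv := eigenpair_generalized Mu eig.
have Du := dtn_denom_unitmx eig.1 Kv LEE_unit.
by split; last exact: DtN_eigenvector.
Qed.
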